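(* Let $A$ be a $C^*$-algebra, and let $\theta$ be a bounded linear map from a Banach right $A$-module $E$ into a Hilbert $A$-module $F$. Then $\theta$ is a right $A$-module map if and only if $\theta$ is local, in the sense that $\theta(e)a=0$ whenever $e\in E$ and $a\in A$ satisfy $ea=0$.
   Context: All notions are standard. *)

(* Defs.v *)
From HB Require Import structures.
From mathcomp Require Import all_boot all_order all_algebra.
From mathcomp Require Import complex.
From mathcomp Require Import boolp classical_sets reals topology normedtype.
Set Implicit Arguments.
Unset Strict Implicit.
Unset Printing Implicit Defensive.
Import Order.TTheory GRing.Theory Num.Theory.
Import numFieldNormedType.Exports.
Local Open Scope ring_scope.
Local Open Scope complex_scope.

(* The scalars are R[i], the complex numbers over R : realType.  Norms of
   normed R[i]-modules take their values in R[i]; they lie on the nonnegative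
   real half-line, since 0 <= z in R[i] means that z is real and
   nonnegative. *)

(* C*-algebras are not assumed to be unital, and MathComp's rings are; hence
   the product is introduced here as an operation on a Banach space. *)
HB.mixin Record isCStarAlgebra (R : realType) A
    of CompleteNormedModule R[i] A := {
  amul : A -> A -> A ;
  astar : A -> A ;
  amulA : forall a b c, amul a (amul b c) = amul (amul a b) c ;
  amul_linearl : forall l a b c,
    amul (l *: a + b) c = l *: amul a c + amul b c ;
  amul_linearr : forall l a b c,
    amul a (l *: b + c) = l *: amul a b + amul a c ;
  normr_amul : forall a b, `|amul a b| <= `|a| * `|b| ;
  astar_antilinear : forall (l : R[i]) a b,
    astar (l *: a + b) = Num.conj l *: astar a + astar b ;
  astarK : forall a, astar (astar a) = a ;
  astarM : forall a b, astar (amul a b) = amul (astar b) (astar a) ;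
  normr_cstar : forall a, `|amul (astar a) a| = `|a| ^+ 2
}.

#[short(type="cstarAlgType")]
HB.structure Definition CStarAlgebra (R : realType) :=
  {A of CompleteNormedModule R[i] A & isCStarAlgebra R A}.

Section Positivity.
Context {R : realType} {A : cstarAlgType R}.

(* Product of the unitization of A; (a, l) stands for a + l 1. *)
Definition unitization_mul (x y : A * R[i]) : A * R[i] :=
  (amul x.1 y.1 + x.2 *: y.1 + y.2 *: x.1, x.2 * y.2).

Definition unitization_invertible (x : A * R[i]) : Prop :=
  exists y, unitization_mul x y = (0, 1) /\ unitization_mul y x = (0, 1).

(* The spectrum is taken in the unitization.  When A already has a unit this
   may add the point 0, which is immaterial for positivity. *)
Definition spectrum (a : A) : set R[i] :=
  [set l | ~ unitization_invertible (a, - l)]%classic.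

Definition apositive (a : A) : Prop :=
  astar a = a /\ (forall l, spectrum a l -> 0 <= l).

End Positivity.

HB.mixin Record hasRightAction (R : realType) (A : cstarAlgType R) E
    of CompleteNormedModule R[i] E := {
  ract : E -> A -> E ;
  ract_linearl : forall l e f a,
    ract (l *: e + f) a = l *: ract e a + ract f a ;
  ract_linearr : forall l e a b,
    ract e (l *: a + b) = l *: ract e a + ract e b ;
  ractM : forall e a b, ract e (amul a b) = ract (ract e a) b
}.

(* A right A-module whose underlying vector space is a Banach space; nothing
   relates the action to the norms yet. *)
#[short(type="rightModType")]
HB.structure Definition RightModule (R : realType) (A : cstarAlgType R) :=
  {E of CompleteNormedModule R[i] E & hasRightAction R A E}.

(* The bound K is arbitrary; contractive modules are the case K = 1. *)
HB.mixin Record isBanachRightModule (R : realType) (A : cstarAlgType R) E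
    of RightModule R A E := {
  ract_bounded : exists K : R[i], forall (e : E) (a : A),
    `|ract e a| <= K * `|e| * `|a|
}.

#[short(type="banachRightModType")]
HB.structure Definition BanachRightModule (R : realType)
    (A : cstarAlgType R) :=
  {E of RightModule R A E & isBanachRightModule R A E}.

(* The inner product is A-linear in its second argument.  The last axiom says
   that the norm of F is the one given by the inner product, and F is complete
   for it. *)
HB.mixin Record isHilbertModule (R : realType) (A : cstarAlgType R) F
    of RightModule R A F := {
  inner : F -> F -> A ;
  inner_linearr : forall l x y z,
    inner x (l *: y + z) = l *: inner x y + inner x z ;
  inner_ract : forall x y a, inner x (ract y a) = amul (inner x y) a ;
  inner_star : forall x y, astar (inner x y) = inner y x ;
  inner_ge0 : forall x, apositive (inner x x) ;
  inner_eq0 : forall x, inner x x = 0 -> x = 0 ;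
  normr_inner : forall x, `|x| ^+ 2 = `|inner x x|
}.

#[short(type="hilbertModType")]
HB.structure Definition HilbertModule (R : realType) (A : cstarAlgType R) :=
  {F of RightModule R A F & isHilbertModule R A F}.

Definition bounded_operator (K : numFieldType) (E F : normedModType K)
    (theta : E -> F) : Prop :=
  exists M : K, forall e, `|theta e| <= M * `|e|.

Section Maps.
Context {R : realType} {A : cstarAlgType R} {E F : rightModType A}.

Definition right_module_map (theta : E -> F) : Prop :=
  forall e a, theta (ract e a) = ract (theta e) a.

Definition local_map (theta : E -> F) : Prop :=
  forall (e : E) (a : A), ract e a = 0 -> ract (theta e) a = 0.

End Maps.

(* Main.v *)
(* Replacing [A] by its unitization, fix [e] and a self-adjoint contraction [h],
   and consider [V (x, y) = theta (e x) y] on the commutative algebra generated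
   by [h].  Locality says that [V (x, y) = 0] whenever [x y = 0], and the point
   is that [V (h, 1) = V (1, h)].

   Splitting [h] repeatedly into the affine rescalings [2 h_+ - 1] and
   [1 - 2 h_-] of its positive and negative parts writes [h] as the mean of
   [n = 2 ^ m] contractions [v_1, ..., v_n] with [(1 + v_j) (1 - v_k) = 0] for
   [j < k] (the spectrum is cut into [n] intervals, and [v_j] varies on the
   [j]-th one only).  With [d_j = v_(j+1) - v_j], locality gives
   [2 (V (v_j, 1) - V (1, v_j)) = V (d_(j-1), d_j) - V (d_j, d_(j-1))].
   Within a class of indices modulo 3 the [d_j] are mutually orthogonal, hence
   the sum of the [V (d_(j-1), d_j)] over the class is the single value of [V]
   at two elements of norm at most 2.  So [n |V (h, 1) - V (1, h)|] is bounded
   independently of [n].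

   No spectral theory is needed: square roots come from a dominated iteration,
   and all norm estimates from [|x| ^ 2 <= |x ^ 2 + y ^ 2|] for commuting
   self-adjoint [x] and [y]. *)
From HB Require Import structures.
Require Import Defs.
From mathcomp Require Import all_boot all_order all_algebra.
From mathcomp Require Import ring lra zify.
From mathcomp Require Import complex.
From mathcomp Require Import boolp classical_sets reals topology normedtype.
Set Implicit Arguments.
Unset Strict Implicit.
Unset Printing Implicit Defensive.
Import Order.TTheory GRing.Theory Num.Theory.
Import numFieldNormedType.Exports.
Local Open Scope ring_scope.

(** * Commutative algebras with a C*-bound *)

(** By Bernoulli's inequality. It lets a bound on [2 ^ k]-th powers that is uniform in [k] pass to
    the base. *)
Lemma expr_pow2_unbounded (R : realType) (c a : R) :
  1 < c -> exists k, a <= c ^+ (2 ^ k).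
Proof.
move=> c_gt1; have d_gt0 : 0 < c - 1 by rewrite subr_gt0.
have bern n : n%:R * (c - 1) <= c ^+ n.
  have ge1 m : 1 <= c ^+ m by apply: exprn_ege1; exact: ltW.
  elim: n => [|n IHn]; first by rewrite mul0r expr0.
  have : c ^+ n.+1 = c ^+ n + (c - 1) * c ^+ n by rewrite exprS; ring.
  have : c - 1 <= (c - 1) * c ^+ n by rewrite ler_peMr // ltW.
  have -> : n.+1%:R * (c - 1) = n%:R * (c - 1) + (c - 1).
    by rewrite -natr1; ring.
  lra.
exists (Num.bound (a / (c - 1))).
have := unstable.ltr_bound (a / (c - 1)).
set k := Num.bound _; rewrite ltr_pdivrMr // => lt_k.
apply/ltW/(lt_le_trans lt_k)/(le_trans (bern k)).
by rewrite ler_eXn2l // ltnW // ltn_expl.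
Qed.

(* Abstract form of the self-adjoint part of a unital commutative C*-algebra:
   [bd x c] stands for [|x| <= c], and [gauge_sqrD] is the only trace of the
   C*-identity. *)
Record cstar_gauge (R : realType) (B : comNzRingType) (bd : B -> R -> Prop) :
    Prop := CstarGauge {
  gauge_le : forall x c d, c <= d -> bd x c -> bd x d ;
  gauge_closed : forall x c, (forall e, 0 < e -> bd x (c + e)) -> bd x c ;
  gauge_fin : forall x, exists c, bd x c ;
  gauge_eq0 : forall x, bd x 0 -> x = 0 ;
  gauge0 : bd 0 0 ;
  gauge1 : bd 1 1 ;
  gaugeN : forall x c, bd x c -> bd (- x) c ;
  gaugeD : forall x y c d, bd x c -> bd y d -> bd (x + y) (c + d) ;
  gaugeM : forall x y c d, bd x c -> bd y d -> bd (x * y) (c * d) ;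
  gauge_sqrD : forall x y c,
    0 <= c -> bd (x ^+ 2 + y ^+ 2) (c ^+ 2) -> bd x c ;
  gauge_half : exists2 h : B, h + h = 1 & bd h 2^-1 ;
  gauge_complete : forall (f : nat -> B) (t : nat -> R),
    (forall k, bd (f k.+1 - f k) (t k.+1 - t k)) -> (forall k, t k <= 1) ->
    exists x, forall e, 0 < e -> exists k, bd (x - f k) e /\ bd (x - f k.+1) e
}.

Section Gauge.
Context (R : realType) (B : comNzRingType) (bd : B -> R -> Prop).
Hypothesis gbd : cstar_gauge bd.
Implicit Types (x y z v w : B) (c d e : R).

Lemma gauge_sqr x c : 0 <= c -> bd (x ^+ 2) (c ^+ 2) -> bd x c.
Proof.
move=> c0 bx; apply: (gauge_sqrD gbd (y := 0)) => //.
by rewrite expr0n addr0.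
Qed.

Lemma gauge_circle x y : x ^+ 2 + y ^+ 2 = 1 -> bd x 1.
Proof.
move=> xy1; apply: (gauge_sqrD gbd (y := y)) => //.
by rewrite xy1 expr1n; exact: gauge1.
Qed.

Lemma gauge_expr2 x : bd x 1 -> bd (x ^+ 2) 1.
Proof.
by move=> bx; rewrite expr2 -[X in bd _ X](mulr1 1); exact: gaugeM.
Qed.

Lemma gauge_pow2 k x c : 0 <= c -> bd (x ^+ (2 ^ k)) (c ^+ (2 ^ k)) -> bd x c.
Proof.
move=> c0; elim: k => [|k IHk]; first by rewrite !expr1.
rewrite expnSr !exprM => bxk.
by apply/IHk/gauge_sqr; rewrite ?exprn_ge0.
Qed.

Lemma gauge_small x c : 0 <= c -> (forall e, 0 < e -> bd x (c * e)) -> x = 0.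
Proof.
move=> c0 bx; apply: (gauge_eq0 gbd); apply: (gauge_closed gbd) => e e0.
have c1 : 0 < c + 1 by lra.
apply: gauge_le (bx (e / (c + 1)) _) => //; last exact: divr_gt0.
by rewrite add0r mulrA ler_pdivrMr //; nra.
Qed.

Let t := fix t k : R := if k is k'.+1 then (1 + t k' ^+ 2) / 2 else 0.

Let t_itv k : 0 <= t k <= 1.
Proof. by elim: k => [|k] /=; first lra; move: (t k) => u; nra. Qed.

(* The iteration [f k.+1 = (z + f k ^ 2) / 2] converges to [1 - sqrt (1 - z)];
   it is dominated by the scalar sequence [t], which is the case [z = 1]. *)
Lemma gauge_sqrt z : bd z 1 ->
  exists s, [/\ bd s 1, (1 - s) ^+ 2 = 1 - z
    & forall b, z * b = 0 -> s * b = 0].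
Proof.
move=> bz; have [h hh bh] := gauge_half gbd.
pose f := fix f k := if k is k'.+1 then h * (z + f k' ^+ 2) else 0 : B.
have fS k : f k.+1 = h * (z + f k ^+ 2) by [].
have tS k : t k.+1 = (1 + t k ^+ 2) / 2 by [].
have bf k : bd (f k) (t k).
  elim: k => [|k IHk]; first exact: gauge0.
  rewrite /= mulrC; apply: gaugeM => //; apply: gaugeD => //.
  by rewrite !expr2; exact: gaugeM.
(* Each new step is half a difference of squares, for [f] and for [t] alike, so the domination is
   inherited. *)
have bdf k : bd (f k.+1 - f k) (t k.+1 - t k).
  elim: k => [|k IHk].
    rewrite /= expr0n expr0n /= !addr0 !subr0 mulrC.
    exact: gaugeM.
  have -> : f k.+2 - f k.+1 = h * ((f k.+1 - f k) * (f k.+1 + f k)).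
    by rewrite (fS k.+1) {2}(fS k); ring.
  have -> : t k.+2 - t k.+1 = 2^-1 * ((t k.+1 - t k) * (t k.+1 + t k)).
    by rewrite (tS k.+1) {2}(tS k); field.
  by apply: gaugeM => //; apply: gaugeM => //; exact: gaugeD.
have [|s cvs] := gauge_complete gbd bdf.
  by move=> k; case/andP: (t_itv k).
have bs : bd s 1.
  apply: (gauge_closed gbd) => e /cvs[k [bk _]].
  have -> : s = f k + (s - f k) by ring.
  apply: gaugeD => //; apply: gauge_le (bf k) => //.
  by case/andP: (t_itv k).
exists s; split => // [|b zb0].
- apply/eqP; rewrite -subr_eq0; apply/eqP.
  apply: (@gauge_small _ 4) => // e e0.
  have [k [bk bk1]] := cvs e e0.
  have -> : (1 - s) ^+ 2 - (1 - z) =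
      (s - f k) * (s + f k) - (1 + 1) * (s - f k.+1).
    have E : f k.+1 + f k.+1 = z + f k ^+ 2 by rewrite /= -mulrDl hh mul1r.
    have -> : z = f k.+1 + f k.+1 - f k ^+ 2 by rewrite E; ring.
    ring.
  have -> : 4 * e = e * (1 + 1) + (1 + 1) * e by ring.
  apply: gaugeD => //; last first.
    apply: gaugeN => //; apply: gaugeM => //.
    exact: (gaugeD gbd (gauge1 gbd) (gauge1 gbd)).
  apply: gaugeM => //; apply: gaugeD => //; apply: gauge_le (bf k) => //.
  by case/andP: (t_itv k).
(* Each iterate is a polynomial in [z] without constant term, so [b] kills it, and then the
   limit. *)
- have fb k : f k * b = 0.
    by elim: k => [|k IHk] /=; rewrite ?mul0r // -mulrA mulrDl zb0 add0r
      expr2 -mulrA IHk !mulr0.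
  have [d bb] := gauge_fin gbd b.
  apply: (@gauge_small _ `|d|) => // e /cvs[k [bk _]].
  have -> : s * b = b * (s - f k) by rewrite mulrBr [b * f k]mulrC fb; ring.
  apply: gaugeM => //; apply: gauge_le bb => //; exact: ler_norm.
Qed.

Lemma gauge_sqrt1 z : bd (1 - z) 1 -> exists s, s ^+ 2 = z.
Proof. by move=> /gauge_sqrt[s [_ es _]]; exists (1 - s); rewrite es subKr. Qed.

Lemma gauge_sqr_compl v : bd v 1 -> exists2 q, q ^+ 2 = 1 - v ^+ 2 & bd q 1.
Proof.
move=> bv; have [|s [_ es _]] := @gauge_sqrt (v ^+ 2).
  exact: gauge_expr2.
exists (1 - s) => //; apply: (@gauge_circle _ v); rewrite es; ring.
Qed.

(** The square of an orthogonal sum is the sum of the squares, again orthogonal. After [k] squarings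
    the triangle inequality costs a factor [N], of which only the [2 ^ k]-th root remains. *)
Lemma gauge_orth_sum k N (a : 'I_N -> B) c :
  (forall i j, i != j -> a i * a j = 0) -> (forall i, bd (a i) 1) ->
  0 <= c -> N%:R <= c ^+ (2 ^ k) -> bd (\sum_i a i) c.
Proof.
elim: k a c => [|k IHk] a c orth ba c0 Nc.
  move: Nc; rewrite expr1 => Nc; apply: gauge_le Nc _ => //.
  elim: N a {orth} ba => [|N IHN] a ba.
    by rewrite big_ord0; exact: gauge0.
  rewrite big_ord_recl -natr1 addrC; apply: gaugeD => //; last exact: IHN.
apply: gauge_sqr => //.
have -> : (\sum_i a i) ^+ 2 = \sum_i a i ^+ 2.
  rewrite expr2 mulr_suml; apply: eq_bigr => i _.
  rewrite mulr_sumr (bigD1 i) //= big1 ?addr0 ?expr2 // => j ji.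
  by rewrite orth // eq_sym.
apply: IHk => [i j ij|i||].
- by rewrite -exprMn orth // expr0n.
- exact: gauge_expr2.
- exact: exprn_ge0.
- by rewrite -exprM -expnS.
Qed.

(** As [k] grows, the [2 ^ k]-th root of [N] tends to 1. *)
Lemma gauge_orth N (a : 'I_N -> B) :
  (forall i j, i != j -> a i * a j = 0) -> (forall i, bd (a i) 1) ->
  bd (\sum_i a i) 1.
Proof.
move=> orth ba; apply: (gauge_closed gbd) => e e0.
have [|k Nk] := @expr_pow2_unbounded _ (1 + e) N%:R; first by rewrite ltrDl.
by apply: (@gauge_orth_sum k) => //; lra.
Qed.

(* The hypotheses are stable under squaring [a], [b] and [g], so that [a] to
   the power [2 ^ k] stays bounded by 2. *)
Lemma gauge_pair a b g : bd g 1 ->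
  a ^+ 2 + b ^+ 2 = 1 + g ^+ 2 -> (a ^+ 2 - 1) * (b ^+ 2 - 1) = 0 -> bd a 1.
Proof.
move=> bg e1 e2.
have iter k : exists b' g', [/\ bd g' 1,
    (a ^+ (2 ^ k)) ^+ 2 + b' ^+ 2 = 1 + g' ^+ 2 &
    ((a ^+ (2 ^ k)) ^+ 2 - 1) * (b' ^+ 2 - 1) = 0].
  elim: k => [|k [b' [g' [bg' E1 E2]]]]; first by exists b, g; rewrite expr1.
  exists (b' ^+ 2), (g' ^+ 2); rewrite expnSr exprM.
  move: E1 E2; set a' := a ^+ _ => E1 E2; split.
  - exact: gauge_expr2.
  - have -> : g' ^+ 2 = a' ^+ 2 + b' ^+ 2 - 1 by rewrite E1; ring.
    (* Squaring spoils the first relation only by a multiple of the second. *)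
    have -> : (a' ^+ 2) ^+ 2 + (b' ^+ 2) ^+ 2 =
      1 + (a' ^+ 2 + b' ^+ 2 - 1) ^+ 2 -
      2%:R * ((a' ^+ 2 - 1) * (b' ^+ 2 - 1)) by ring.
    by rewrite E2 mulr0 subr0.
  - have -> : ((a' ^+ 2) ^+ 2 - 1) * ((b' ^+ 2) ^+ 2 - 1) =
      (a' ^+ 2 - 1) * (b' ^+ 2 - 1) * ((a' ^+ 2 + 1) * (b' ^+ 2 + 1)) by ring.
    by rewrite E2 mul0r.
apply: (gauge_closed gbd) => e e0.
have [|k k2] := @expr_pow2_unbounded _ (1 + e) 2; first by rewrite ltrDl.
have [b' [g' [bg' E1 _]]] := iter k.
have e1_ge1 : 1 <= (1 + e) ^+ (2 ^ k) by apply: exprn_ege1; lra.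
apply: (@gauge_pow2 k); first lra.
apply: (gauge_sqrD gbd (y := b')); first lra.
rewrite E1; apply: gauge_le (_ : 1 + 1 <= _) _ => //; first nra.
apply: gaugeD => //; first exact: gauge1.
exact: gauge_expr2.
Qed.

(* With [w = |v|], the two parts are the affine rescalings
   [2 v_+ - 1] and [1 - 2 v_-] of the positive and negative parts of [v]. *)
Lemma gauge_split v : bd v 1 -> exists v1 v2,
  [/\ bd v1 1, bd v2 1, v1 + v2 = v *+ 2, (1 + v1) * (1 - v2) = 0
    & forall b, v * b = b \/ v * b = - b -> v1 * b = v * b /\ v2 * b = v * b].
Proof.
move=> bv; have [q eq bq] := gauge_sqr_compl bv.
have [|s [bs es sb]] := @gauge_sqrt (1 - v ^+ 2).
  by rewrite -eq; exact: gauge_expr2.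
pose w := 1 - s; have ew : w ^+ 2 = v ^+ 2 by rewrite es; ring.
have bw : bd w 1.
  by apply: gauge_sqr => //; rewrite ew !expr2; exact: gaugeM.
have [|m em] := @gauge_sqrt1 w; first by rewrite /w subKr.
have bm : bd m 1 by apply: gauge_sqr; rewrite ?em ?expr1n.
have [l el _] := gauge_sqr_compl bm.
(* Since [m ^ 2 = w] and [l ^ 2 = 1 - w], the circle identity is
   [(2 w - 1) ^ 2 + 4 w (1 - w) = 1]. *)
have bg : bd (2%:R * w - 1) 1.
  apply: (@gauge_circle _ (2%:R * (m * l))).
  by rewrite !exprMn el em; ring.
exists (v + w - 1), (v - w + 1).
have e1 : (v + w - 1) ^+ 2 + (w - v - 1) ^+ 2 = 1 + (2%:R * w - 1) ^+ 2.
  have -> : (v + w - 1) ^+ 2 + (w - v - 1) ^+ 2 =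
    w ^+ 2 *+ 2 + v ^+ 2 *+ 2 - 4%:R * w + 2%:R by ring.
  by rewrite -ew; ring.
have e2 : ((v + w - 1) ^+ 2 - 1) * ((w - v - 1) ^+ 2 - 1) = 0.
  have -> : ((v + w - 1) ^+ 2 - 1) * ((w - v - 1) ^+ 2 - 1) =
    (w ^+ 2 - v ^+ 2) * ((v + w - 2%:R) * (w - v - 2%:R)) by ring.
  by rewrite ew subrr mul0r.
split.
- exact: gauge_pair e1 e2.
- have -> : v - w + 1 = - (w - v - 1) by ring.
  apply: gaugeN => //; apply: (gauge_pair bg (b := v + w - 1)).
    by rewrite addrC.
  by rewrite mulrC.
- by ring.
- have -> : (1 + (v + w - 1)) * (1 - (v - w + 1)) = w ^+ 2 - v ^+ 2 by ring.
  by rewrite ew subrr.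
(* Where [v] is 1 or -1, [w] is 1, and both rescalings agree with [v]. *)
- move=> b vb; have v2b : (1 - v ^+ 2) * b = 0.
    rewrite mulrBl expr2 -mulrA mul1r.
    by case: vb => E; rewrite E ?mulrN E ?opprK subrr.
  have wb : w * b = b by rewrite mulrBl mul1r sb // subr0.
  by rewrite mulrBl mulrDl wb mul1r addrK mulrDl mulrBl wb mul1r subrK.
Qed.

(** Split [v], then chain each half. The last clause serves the induction: the values 1 and -1
    survive every split, which makes the two half-chains compatible. *)
Lemma gauge_chain m v : bd v 1 -> exists L : seq B,
  [/\ forall x, x \in L -> bd x 1, \sum_(x <- L) x = v *+ (2 ^ m),
      pairwise (fun x y => (1 + x) * (1 - y) == 0) L
    & forall b, v * b = b \/ v * b = - b -> forall x, x \in L -> x * b = v * b].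
Proof.
elim: m v => [|m IHm] v bv.
  exists [:: v]; split => //=; first by move=> x; rewrite inE => /eqP ->.
    by rewrite big_seq1.
  by move=> b _ x; rewrite inE => /eqP ->.
have [v1 [v2 [bv1 bv2 ev ch vb]]] := gauge_split bv.
have [L1 [bL1 sL1 pL1 iL1]] := IHm _ bv1.
have [L2 [bL2 sL2 pL2 iL2]] := IHm _ bv2.
exists (L1 ++ L2); split.
- by move=> x; rewrite mem_cat => /orP[/bL1|/bL2].
- by rewrite big_cat /= sL1 sL2 -mulrnDl ev -mulrnA expnS.
- rewrite pairwise_cat pL1 pL2 !andbT; apply/allrelP => x y xL yL.
  (* On [1 - v2], [v1] acts as -1, hence so does each [x] of the first chain. Then [v2] acts as 1 on
     [1 + x], hence so does each [y] of the second. *)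
  have e1 : v1 * (1 - v2) = - (1 - v2).
    by apply/eqP; rewrite -addr_eq0 -[X in _ + X]mul1r -mulrDl addrC ch.
  have e2 : x * (1 - v2) = - (1 - v2) by rewrite (iL1 _ _ x) //; right.
  have e3 : v2 * (1 + x) = 1 + x.
    apply/eqP; rewrite -subr_eq0.
    have -> : v2 * (1 + x) - (1 + x) = - (x * (1 - v2)) - (1 - v2) by ring.
    by rewrite e2 opprK subrr.
  have e4 : y * (1 + x) = v2 * (1 + x) by apply: iL2 => //; left.
  by rewrite mulrC mulrBl mul1r e4 e3 subrr.
- move=> b hb x; have [h1 h2] := vb b hb; rewrite mem_cat => /orP[xL|xL].
    by rewrite (iL1 b) // h1.
  by rewrite (iL2 b) // h2.
Qed.

(** * Biadditive maps vanishing on pairs with zero product *)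

Section ZeroProduct.
Context (K : numDomainType) (W : normedZmodType K) (V : B -> B -> W) (C : K).
Hypothesis VDl : forall x y z, V (x + y) z = V x z + V y z.
Hypothesis VDr : forall x y z, V x (y + z) = V x y + V x z.
Hypothesis V0 : forall x y, x * y = 0 -> V x y = 0.
Hypothesis bV : forall x y, bd x 2 -> bd y 2 -> `|V x y| <= C.

Let VBl x y z : V (x - y) z = V x z - V y z.
Proof. by apply/eqP; rewrite eq_sym subr_eq -VDl subrK. Qed.

Let VBr x y z : V x (y - z) = V x y - V x z.
Proof. by apply/eqP; rewrite eq_sym subr_eq -VDr subrK. Qed.

Let Vsuml I (r : seq I) (F : I -> B) z :
  V (\sum_(i <- r) F i) z = \sum_(i <- r) V (F i) z.
Proof.
by apply: (big_morph (V^~ z)) => [x y|]; rewrite ?VDl // V0 // mul0r.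
Qed.

Let Vsumr I (r : seq I) (F : I -> B) z :
  V z (\sum_(i <- r) F i) = \sum_(i <- r) V z (F i).
Proof. by apply: (big_morph (V z)) => [x y|]; rewrite ?VDr // V0 // mulr0. Qed.

Let gauge_orth2 N (a : 'I_N -> B) :
  (forall i j, i != j -> a i * a j = 0) -> (forall i, bd (a i) 2) ->
  bd (\sum_i a i) 2.
Proof.
move=> orth ba; have [h hh bh] := gauge_half gbd.
have -> : \sum_i a i = (1 + 1) * \sum_i h * a i.
  by rewrite -mulr_sumr mulrA mulrDl mul1r hh mul1r.
rewrite -[2]mulr1; apply: gaugeM => //.
  exact: (gaugeD gbd (gauge1 gbd) (gauge1 gbd)).
apply: gauge_orth => [i j ij|i].
  by rewrite mulrACA orth // mulr0.
have -> : 1 = 2^-1 * 2 :> R by rewrite mulVf // pnatr_eq0.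
exact: (gaugeM gbd).
Qed.

(* Grouping the indices modulo 3 makes all the cross terms vanish, so each
   class contributes a single value of [V]. *)
Let diff_sum (d : nat -> B) n :
  (forall j, bd (d j) 2) ->
  (forall j k, (j.+1 < k)%N || (k.+1 < j)%N -> d j * d k = 0) ->
  `|\sum_(j < n * 3) V (d j) (d j.+1)| <= C *+ 3 /\
  `|\sum_(j < n * 3) V (d j.+1) (d j)| <= C *+ 3.
Proof.
move=> bd2 dd.
have sum3 (F : nat -> W) : \sum_(j < n * 3) F j = \sum_(i < n) F (i * 3)%N +
    \sum_(i < n) F (i * 3).+1 + \sum_(i < n) F (i * 3).+2.
  rewrite -!big_split; elim: n => [|m IHm]; first by rewrite !big_ord0.
  by rewrite mulSn !big_ord_recr /= IHm !addrA.
have neq (i j : 'I_n) : i != j -> (i < j)%N || (j < i)%N by rewrite -neq_ltn.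
have term r :
    `|\sum_(i < n) V (d (r + i * 3)%N) (d (r + i * 3).+1)| <= C /\
    `|\sum_(i < n) V (d (r + i * 3).+1) (d (r + i * 3)%N)| <= C.
  have bl : bd (\sum_(i < n) d (r + i * 3)%N) 2.
    by apply: gauge_orth2 => // i j /neq ij; apply: dd; lia.
  have br : bd (\sum_(i < n) d (r + i * 3).+1) 2.
    by apply: gauge_orth2 => // i j /neq ij; apply: dd; lia.
  have -> : \sum_(i < n) V (d (r + i * 3)%N) (d (r + i * 3).+1) =
      V (\sum_(i < n) d (r + i * 3)%N) (\sum_(i < n) d (r + i * 3).+1).
    (* Cross terms pair the indices [r + 3 i] and [r + 3 j + 1] with [i] and [j] distinct; these are
       at least 2 apart. *)
    rewrite Vsuml; apply: eq_bigr => i _; rewrite Vsumr (bigD1 i) //=.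
    by rewrite big1 ?addr0 // => j /neq ji; apply/V0/dd; lia.
  have -> : \sum_(i < n) V (d (r + i * 3).+1) (d (r + i * 3)%N) =
      V (\sum_(i < n) d (r + i * 3).+1) (\sum_(i < n) d (r + i * 3)%N).
    rewrite Vsuml; apply: eq_bigr => i _; rewrite Vsumr (bigD1 i) //=.
    by rewrite big1 ?addr0 // => j /neq ji; apply/V0/dd; lia.
  by split; exact: bV.
have [[l0 r0] [l1 r1] [l2 r2]] := And3 (term 0) (term 1) (term 2).
rewrite (sum3 (fun j => V (d j) (d j.+1))) (sum3 (fun j => V (d j.+1) (d j))).
have le3 (x y z : W) :
    `|x| <= C -> `|y| <= C -> `|z| <= C -> `|x + y + z| <= C *+ 3.
  move=> xC yC zC; rewrite 2!mulrSr mulr1n; apply: le_trans (ler_normD _ _) _.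
  by rewrite lerD // (le_trans (ler_normD _ _)) ?lerD.
by split; apply: le3.
Qed.

(** Write the differences as [(1 + u j.+1) - (1 + u j)] and [(1 - u j.+1) - (1 - u j.+2)]. Only the
    values of [V] at [1 + u j.+1] and [1 - u j.+1], in both orders, survive; subtracting them
    cancels [V 1 1] and the quadratic terms. *)
Let Vd (u : nat -> B) j :
  (forall j k, (j < k)%N -> (1 + u j) * (1 - u k) = 0) ->
  (V (u j.+1) 1 - V 1 (u j.+1)) *+ 2 =
  V (u j.+1 - u j) (u j.+2 - u j.+1) - V (u j.+2 - u j.+1) (u j.+1 - u j).
Proof.
move=> ch.
have zl i k : (i < k)%N -> V (1 + u i) (1 - u k) = 0.
  by move=> ik; apply/V0/ch.
have zr i k : (i < k)%N -> V (1 - u k) (1 + u i) = 0.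
  by move=> ik; apply: V0; rewrite mulrC ch.
have -> : u j.+1 - u j = (1 + u j.+1) - (1 + u j) by ring.
have -> : u j.+2 - u j.+1 = (1 - u j.+1) - (1 - u j.+2) by ring.
have kl p p' q q' : V p' q' = 0 -> V p q = 0 -> V p q' = 0 ->
    V (p' - p) (q - q') = V p' q.
  by move=> E1 E2 E3; rewrite VBl !VBr E1 E2 E3 !subr0.
have kr p p' q q' : V q' p' = 0 -> V q p = 0 -> V q' p = 0 ->
    V (q - q') (p' - p) = V q p'.
  by move=> E1 E2 E3; rewrite VBl !VBr E1 E2 E3 !subr0.
rewrite kl; [rewrite kr; try exact: zr | exact: zl ..].
have -> : 1 - u j.+1 = 1 + 1 - (1 + u j.+1) by ring.
have [p ep] : exists p, 1 + u j.+1 = p by eexists.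
rewrite ep VBl VBr.
rewrite opprB addrA subrK VDl VDr.
have -> : u j.+1 = p - 1 by rewrite -ep; ring.
by rewrite VBl VBr opprB addrA subrK mulrnBl !mulr2n.
Qed.

Let zero_product_sum (u : nat -> B) n :
  (forall j, bd (u j) 1) ->
  (forall j k, (j < k)%N -> (1 + u j) * (1 - u k) = 0) ->
  `|(\sum_(j < n * 3) (V (u j.+1) 1 - V 1 (u j.+1))) *+ 2| <= C *+ 6.
Proof.
move=> bu ch; rewrite -sumrMnl (eq_bigr _ (fun j _ => Vd _ ch)) sumrB.
pose d j := u j.+1 - u j.
have dd j k : (j.+1 < k)%N -> d j * d k = 0.
  move=> jk; have k1 := ltn_trans (ltnSn j) jk.
  have -> : d j * d k =
     (1 + u j.+1) * (1 - u k) - (1 + u j.+1) * (1 - u k.+1)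
     - (1 + u j) * (1 - u k) + (1 + u j) * (1 - u k.+1) by rewrite /d; ring.
  by rewrite !ch ?subrr ?addr0 // ltnS ltnW.
have [||l r] := @diff_sum d n.
- by move=> j; apply: gaugeD => //; exact: gaugeN.
- by move=> j k /orP[|kj]; [exact: dd | rewrite mulrC dd].
by apply: le_trans (ler_normB _ _) _; rewrite (mulrnDr C 3 3) lerD.
Qed.

Lemma zero_product_bound v m :
  bd v 1 -> `|V v 1 - V 1 v| *+ (2 ^ m) <= C *+ 6.
Proof.
move=> /(gauge_chain m)[L [bL sL pL _]].
(* Padding by -1 in front and by 1 behind keeps the chain relation. The -1 gives the first entry a
   predecessor; the 1s contribute nothing to the sum and extend it to a length divisible by 3. *)
pose u j := if j is j'.+1 then nth 1 L j' else - 1 : B.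
have bu j : bd (u j) 1.
  case: j => [|j] /=; first by apply: gaugeN => //; exact: gauge1.
  case: (ltnP j (size L)) => jL; first exact/bL/mem_nth.
  by rewrite nth_default //; exact: gauge1.
have ch j k : (j < k)%N -> (1 + u j) * (1 - u k) = 0.
  case: k => // k; case: j => [|j] jk /=; first by rewrite subrr mul0r.
  case: (ltnP k (size L)) => kL.
    apply/eqP; move/(pairwiseP 1): pL; apply; rewrite ?inE //.
    exact: ltn_trans kL.
  by rewrite [nth 1 L k]nth_default // subrr mulr0.
have := zero_product_sum (size L) bu ch.
have -> : \sum_(j < size L * 3) (V (u j.+1) 1 - V 1 (u j.+1)) =
    (V v 1 - V 1 v) *+ 2 ^ m.
  rewrite -(big_mkord xpredT (fun j => V (u j.+1) 1 - V 1 (u j.+1))).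
  rewrite (big_cat_nat (n := size L)) //=; last by rewrite leq_pmulr.
  rewrite [X in _ + X]big_nat_cond [X in _ + X]big1 ?addr0; last first.
    by move=> j /andP[/andP[jL _] _]; rewrite nth_default // subrr.
  rewrite -[LHS](big_nth 1 xpredT (fun x => V x 1 - V 1 x)) sumrB.
  rewrite -Vsuml -Vsumr sL mulrnBl; congr (_ - _).
    elim: (2 ^ m)%N => [|k IHk]; first by rewrite !mulr0n V0 ?mul0r.
    by rewrite !mulrS VDl IHk.
  elim: (2 ^ m)%N => [|k IHk]; first by rewrite !mulr0n V0 ?mulr0.
  by rewrite !mulrS VDr IHk.
move=> le6; apply: le_trans le6; rewrite !normrMn.
by rewrite -mulrnA ler_wpMn2l ?normr_ge0 // leq_pmulr.
Qed.

End ZeroProduct.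
End Gauge.

(** * Norms and Cauchy sequences *)

Section RealNorm.
Context {R : realType}.
Local Notation "r %:C" := (real_complex R r).

(** Estimates are carried out in [R], which is totally ordered, unlike [R[i]]. *)
Definition rnorm (V : normedZmodType R[i]) (x : V) : R := complex.Re `|x|.

Lemma rnormE (V : normedZmodType R[i]) (x : V) : `|x| = (rnorm x)%:C.
Proof. by rewrite /rnorm RRe_real // normr_real. Qed.

Lemma rnorm_ge0 (V : normedZmodType R[i]) (x : V) : 0 <= rnorm x.
Proof. by rewrite -ler0c -rnormE. Qed.

Lemma rnorm0 (V : normedZmodType R[i]) : rnorm (0 : V) = 0.
Proof. by rewrite /rnorm normr0. Qed.

Lemma rnorm1 : rnorm (1 : R[i]) = 1.
Proof. by rewrite /rnorm normr1. Qed.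

Lemma rnorm_eq0 (V : normedZmodType R[i]) (x : V) : rnorm x <= 0 -> x = 0.
Proof. by rewrite -lecR -rnormE normr_le0 => /eqP. Qed.

Lemma rnormN (V : normedZmodType R[i]) (x : V) : rnorm (- x) = rnorm x.
Proof. by rewrite /rnorm normrN. Qed.

Lemma rnormD (V : normedZmodType R[i]) (x y : V) :
  rnorm (x + y) <= rnorm x + rnorm y.
Proof. by rewrite -lecR rmorphD /= -!rnormE ler_normD. Qed.

Lemma rnormZ (V : normedModType R[i]) (l : R[i]) (x : V) :
  rnorm (l *: x) = rnorm l * rnorm x.
Proof. by apply: complexI; rewrite rmorphM /= -!rnormE normrZ. Qed.

Lemma rnormM (l m : R[i]) : rnorm (l * m) = rnorm l * rnorm m.
Proof. by apply: complexI; rewrite rmorphM /= -!rnormE normrM. Qed.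

Lemma rnormC (r : R) : rnorm r%:C = `|r|.
Proof.
by apply: complexI; rewrite -rnormE normc_def /= expr0n addr0 sqrtr_sqr.
Qed.

Lemma conj_real_complex (r : R) : Num.conj r%:C = r%:C.
Proof. exact: conjc_real. Qed.

Lemma rnorm_small (V : normedZmodType R[i]) (x : V) c :
  (forall e, 0 < e -> rnorm x <= c * e) -> x = 0.
Proof.
move=> small; apply: rnorm_eq0; rewrite leNgt; apply/negP => x0.
have c1 : 0 < `|c| + 1 by rewrite ltr_wpDl.
have := small (rnorm x / (2 * (`|c| + 1))) (divr_gt0 x0 _).
rewrite mulr_gt0 // => /(_ isT); rewrite mulrA ler_pdivlMr ?mulr_gt0 //.
have := ler_norm c; nra.
Qed.

(* The bounds of the definitions are scalars in [R[i]]; they are real except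
   on trivial modules. *)
Lemma le_normM (V : normedZmodType R[i]) (x : V) (K : R[i]) (m : R) :
  0 <= m -> `|x| <= K * m%:C -> rnorm x <= rnorm K * m.
Proof.
move=> m0 xK; rewrite -lecR -rnormE (le_trans xK) //.
rewrite -[K * _]ger0_norm ?(le_trans _ xK) //.
by rewrite normrM rnormE (rnormE m%:C) rnormC ger0_norm // rmorphM.
Qed.

End RealNorm.

Lemma cauchy_seq_lim (K : numFieldType) (V : completeNormedModType K)
    (a : nat -> V) :
  (forall e, 0 < e -> exists N, forall k, (N <= k)%N -> `|a N - a k| < e) ->
  exists l, forall e, 0 < e ->
    exists N, forall k, (N <= k)%N -> `|l - a k| <= e.
Proof.
move=> ca; have : cvgn a.
  apply: cauchy_cvg; apply: cauchy_exP => e e0.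
  have [N aN] := ca _ e0; exists (a N); exists N => // k /aN.
  by rewrite -ball_normE.
move=> /cvg_ex[l al]; exists l => e e0.
by move/cvgrPdist_le: al => /(_ _ e0)[N _ aN]; exists N.
Qed.

Lemma nondecreasing_cauchy (R : realType) (t : nat -> R) :
  (forall k, t k <= t k.+1) -> (forall k, t k <= 1) -> forall e, 0 < e ->
  exists N, forall k, (N <= k)%N -> 0 <= t k - t N < e.
Proof.
move=> t_incr t_le1 e e0.
have st : has_sup (range t).
  by split; [exists (t 0%N), 0%N | exists 1 => _ [k _ <-]].
have [_ [N _ <-] tN] := sup_adherent e0 st.
exists N => k Nk; have : t N <= t k.
  by apply: (@homo_leq _ _ <=%R) Nk => //; exact: le_trans.
have : t k <= sup (range t) by apply: sup_ubound; [case: st | exists k].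
by move=> ? ?; apply/andP; split; lra.
Qed.

(** The steps telescope against the bounded monotone [t]. The distance [d] is abstract so as to
    serve both [A] and [R]. *)
Lemma summable_steps_cauchy (R : realType) (d : nat -> nat -> R)
    (t : nat -> R) c :
  0 <= c -> (forall i j k, d i k <= d i j + d j k) ->
  (forall k, d k k = 0) -> (forall k, d k k.+1 <= c * (t k.+1 - t k)) ->
  (forall k, t k <= t k.+1) -> (forall k, t k <= 1) ->
  forall e, 0 < e -> exists N, forall k, (N <= k)%N -> d N k < e.
Proof.
move=> c0 dtri d0 dt t_incr t_le1 e e0.
have c1 : 0 < c + 1 by rewrite ltr_wpDl.
have [N tN] := nondecreasing_cauchy t_incr t_le1 (divr_gt0 e0 c1).
exists N => k Nk; have : d N k <= c * (t k - t N).
  elim: k Nk => [|k IHk]; first by rewrite leqn0 => /eqP ->; rewrite d0; lra.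
  rewrite leq_eqVlt => /predU1P[<-|]; first by rewrite d0 subrr mulr0.
  by move=> /IHk h; have := dtri N k k.+1; have := dt k; lra.
have /andP[t0] := tN _ Nk; rewrite ltr_pdivlMr // => ? ?; nra.
Qed.

(** * C*-algebras and their unitization *)

Section CStarAlgebra.
Context {R : realType} {A : cstarAlgType R}.
Implicit Types (a b c p q : A) (l : R[i]).

Lemma amulDl a b c : amul (a + b) c = amul a c + amul b c.
Proof. by have := amul_linearl 1 a b c; rewrite !scale1r. Qed.

Lemma amulDr a b c : amul a (b + c) = amul a b + amul a c.
Proof. by have := amul_linearr 1 a b c; rewrite !scale1r. Qed.

Lemma amul0l a : amul 0 a = 0.
Proof. by apply: (addrI (amul 0 a)); rewrite -amulDl !addr0. Qed.

Lemma amul0r a : amul a 0 = 0.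
Proof. by apply: (addrI (amul a 0)); rewrite -amulDr !addr0. Qed.

Lemma amulZl l a b : amul (l *: a) b = l *: amul a b.
Proof. by have := amul_linearl l a 0 b; rewrite amul0l !addr0. Qed.

Lemma amulZr l a b : amul a (l *: b) = l *: amul a b.
Proof. by have := amul_linearr l a b 0; rewrite amul0r !addr0. Qed.

Lemma amulBl a b c : amul (a - b) c = amul a c - amul b c.
Proof. by rewrite amulDl -scaleN1r amulZl scaleN1r. Qed.

Lemma amulBr a b c : amul a (b - c) = amul a b - amul a c.
Proof. by rewrite amulDr -scaleN1r amulZr scaleN1r. Qed.

Lemma astarD a b : astar (a + b) = astar a + astar b.
Proof. by have := astar_antilinear 1 a b; rewrite rmorph1 !scale1r. Qed.

Lemma astar0 : astar 0 = 0 :> A.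
Proof. by apply: (addrI (astar 0)); rewrite -astarD !addr0. Qed.

Lemma astarZ l a : astar (l *: a) = Num.conj l *: astar a.
Proof. by have := astar_antilinear l a 0; rewrite astar0 !addr0. Qed.

Lemma astarB a b : astar (a - b) = astar a - astar b.
Proof. by rewrite astarD -scaleN1r astarZ rmorphN1 scaleN1r. Qed.

Lemma rnorm_amul a b : rnorm (amul a b) <= rnorm a * rnorm b.
Proof. by rewrite -lecR rmorphM /= -!rnormE normr_amul. Qed.

Lemma rnorm_cstar a : rnorm (amul (astar a) a) = rnorm a ^+ 2.
Proof. by apply: complexI; rewrite rmorphXn /= -!rnormE normr_cstar. Qed.

(** From [|b| ^ 2 = |b^* b| <= |b^*| |b|], taken at [a] and at its adjoint. *)
Lemma rnorm_astar a : rnorm (astar a) = rnorm a.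
Proof.
have le b : rnorm b <= rnorm (astar b).
  have := rnorm_amul (astar b) b; rewrite rnorm_cstar expr2.
  have := rnorm_ge0 b; rewrite le0r => /predU1P[-> _|b0].
    exact: rnorm_ge0.
  by rewrite ler_pM2r.
by apply/eqP; rewrite eq_le le andbT; have := le (astar a); rewrite astarK.
Qed.

(** By the C*-identity, testing on [astar a] does what testing on a unit would do. *)
Lemma rnorm_le_amul a (c : R) :
  0 <= c -> (forall b, rnorm (amul a b) <= c * rnorm b) -> rnorm a <= c.
Proof.
move=> c0 /(_ (astar a)); rewrite -[a in amul a _]astarK rnorm_cstar.
have := rnorm_ge0 (astar a); rewrite -[rnorm a]rnorm_astar le0r expr2.
by move=> /predU1P[-> //|a0]; rewrite ler_pM2r.
Qed.

Lemma amul_faithful a : (forall b, amul a b = 0) -> a = 0.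
Proof.
move=> a0; apply/rnorm_eq0/rnorm_le_amul => // b.
by rewrite a0 rnorm0 mul0r.
Qed.

(* [p = ((p + i q) + (p - i q)) / 2], and the commutation hypothesis makes
   both [(p + i q)^* (p + i q)] and [(p - i q)^* (p - i q)] equal to
   [p^* p + q^* q]. *)
Lemma rnorm_sqrD p q : amul (astar p) q = amul (astar q) p ->
  rnorm p ^+ 2 <= rnorm (amul (astar p) p + amul (astar q) q).
Proof.
move=> pq; set S := _ + _.
have nS (i : R[i]) : Num.conj i = - i -> i * i = -1 ->
    rnorm (p + i *: q) ^+ 2 = rnorm S.
  move=> ci i2; rewrite -rnorm_cstar; congr rnorm.
  rewrite astarD astarZ ci !amulDl !amulDr !amulZl !amulZr scalerA mulNr i2.
  by rewrite opprK scale1r pq scaleNr addrA -[_ - _]addrA subrr addr0.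
have ii : 'i%R * 'i%R = -1 :> R[i] by rewrite -expr2 sqrCi.
have n1 := nS _ (conjCi _) ii.
have n2 : rnorm (p + (- 'i) *: q) ^+ 2 = rnorm S.
  by apply: nS; rewrite ?mulrNN // rmorphN /= conjCi.
have n12 : rnorm (p + 'i *: q) = rnorm (p + (- 'i) *: q).
  by apply/eqP; rewrite -(@eqrXn2 _ 2) ?rnorm_ge0 // n1 n2.
have : rnorm (p *+ 2) <= rnorm (p + 'i *: q) *+ 2.
  rewrite mulr2n [leRHS]mulr2n {2}n12; apply: le_trans (rnormD _ _).
  by rewrite scaleNr addrACA subrr addr0.
rewrite -scaler_nat rnormZ -[2%:R](rmorph_nat (real_complex R)) rnormC.
rewrite normr_nat mulr_natl ler_pMn2r // => le.
by rewrite -n1 lerXn2r ?nnegrE ?rnorm_ge0.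
Qed.

Definition unit_alg (A : cstarAlgType R) : Type := (A * R[i])%type.
HB.instance Definition _ := GRing.Zmodule.on (unit_alg A).

Lemma unitization_mulA :
  associative (@unitization_mul R A : unit_alg A -> unit_alg A -> unit_alg A).
Proof.
move=> [a l] [b m] [c n]; rewrite /unitization_mul /=; congr pair.
  2: exact: mulrA.
rewrite !amulDl !amulDr !amulZl !amulZr !scalerDr !scalerA amulA !addrA.
rewrite (mulrC n l) (mulrC n m).
by rewrite [LHS](ACl (1*4*2*5*3*6*7)).
Qed.

Lemma unitization_mul1r : left_id ((0, 1) : unit_alg A)
  (@unitization_mul R A : unit_alg A -> unit_alg A -> unit_alg A).
Proof.
move=> [a l]; rewrite /unitization_mul /= amul0l scaler0 scale1r add0r addr0.
by rewrite mul1r.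
Qed.

Lemma unitization_mulr1 : right_id ((0, 1) : unit_alg A)
  (@unitization_mul R A : unit_alg A -> unit_alg A -> unit_alg A).
Proof.
move=> [a l]; rewrite /unitization_mul /= amul0r scaler0 scale1r !add0r.
by rewrite mulr1.
Qed.

Lemma unitization_mulDl : left_distributive
  (@unitization_mul R A : unit_alg A -> unit_alg A -> unit_alg A) +%R.
Proof.
move=> [a l] [b m] [c n]; congr pair; rewrite /= ?mulrDl //.
by rewrite amulDl scalerDl scalerDr !addrA [LHS](ACl (1*3*5*2*4*6)).
Qed.

Lemma unitization_mulDr : right_distributive
  (@unitization_mul R A : unit_alg A -> unit_alg A -> unit_alg A) +%R.
Proof.
move=> [a l] [b m] [c n]; congr pair; rewrite /= ?mulrDr //.
by rewrite amulDr scalerDl scalerDr !addrA [LHS](ACl (1*3*5*2*4*6)).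
Qed.

Lemma unitization_one_neq0 : ((0, 1) : unit_alg A) != 0.
Proof. by apply/eqP => -[] /eqP; rewrite oner_eq0. Qed.

HB.instance Definition _ := GRing.Zmodule_isNzRing.Build (unit_alg A)
  unitization_mulA unitization_mul1r unitization_mulr1
  unitization_mulDl unitization_mulDr unitization_one_neq0.
End CStarAlgebra.

(** * The unitization acting on [A] from the left, and its operator bound *)

Section UnitAction.
Context {R : realType} {A : cstarAlgType R}.
Implicit Types (a b : A) (x y : unit_alg A) (c d : R).

Definition unit_lact x a : A := amul x.1 a + x.2 *: a.

Lemma unit_lactDl x y a : unit_lact (x + y) a = unit_lact x a + unit_lact y a.
Proof. by rewrite /unit_lact amulDl scalerDl addrACA. Qed.

Lemma unit_lactM x y a : unit_lact (x * y) a = unit_lact x (unit_lact y a).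
Proof.
rewrite /unit_lact /= !amulDl !amulDr !amulZl !amulZr scalerDr !scalerA amulA.
by rewrite !addrA [LHS](ACl (1*3*2*4)).
Qed.

Lemma unit_lact_adjoint x a b :
  astar x.1 = x.1 -> Num.conj x.2 = x.2 ->
  amul (astar (unit_lact x a)) b = amul (astar a) (unit_lact x b).
Proof.
move=> s1 s2; rewrite /unit_lact astarD astarZ astarM s1 s2 amulDl amulDr.
by rewrite amulA amulZl amulZr.
Qed.

(* The operator norm of left multiplication is only a seminorm on the
   unitization when [A] is already unital; bounding the scalar part too makes
   the gauge separating. *)
Definition unit_bound x c : Prop :=
  rnorm x.2 <= c /\ forall a, rnorm (unit_lact x a) <= c * rnorm a.

Lemma unit_bound_ge0 x c : unit_bound x c -> 0 <= c.
Proof. by case=> h _; apply: le_trans h; exact: rnorm_ge0. Qed.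

Lemma unit_bound_le x c d : c <= d -> unit_bound x c -> unit_bound x d.
Proof.
move=> cd [x2 xa]; split=> [|a]; first exact: le_trans cd.
by apply: le_trans (xa a) _; rewrite ler_wpM2r ?rnorm_ge0.
Qed.

Lemma unit_bound_rnorm x : unit_bound x (rnorm x.1 + rnorm x.2).
Proof.
split=> [|a]; first by rewrite lerDr rnorm_ge0.
apply: le_trans (rnormD _ _) _.
by rewrite rnormZ mulrDl lerD2r rnorm_amul.
Qed.

(** The factor 2 pays for removing the scalar part, itself bounded by [c]. *)
Lemma unit_bound_fst x c : unit_bound x c -> rnorm x.1 <= 2 * c.
Proof.
move=> bx; have c0 := unit_bound_ge0 bx; have [x2 xa] := bx.
apply: rnorm_le_amul => [|a]; first lra.
have -> : amul x.1 a = unit_lact x a - x.2 *: a by rewrite addrK.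
apply: le_trans (rnormD _ _) _; rewrite rnormN rnormZ.
have := xa a; have := rnorm_ge0 a; nra.
Qed.

Lemma unit_bound0 x : unit_bound x 0 -> x = 0.
Proof.
move=> bx; have [x2 _] := bx; have x1 := unit_bound_fst bx.
rewrite mulr0 in x1; move: x x2 x1 {bx} => [a l] /= x2 x1.
by congr pair; exact: rnorm_eq0.
Qed.

Lemma unit_bound_closed x c :
  (forall e, 0 < e -> unit_bound x (c + e)) -> unit_bound x c.
Proof.
move=> bx; split=> [|a].
  by apply/ler_addgt0Pr => e /bx[].
apply/ler_addgt0Pr => e e0; have a1 : 0 < rnorm a + 1.
  by rewrite ltr_wpDl ?rnorm_ge0.
have [_ /(_ a)] := bx _ (divr_gt0 e0 a1).
move=> h; apply: (le_trans h); rewrite mulrDl lerD2l mulrAC ler_pdivrMr //.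
by have := rnorm_ge0 a; nra.
Qed.

Lemma unit_boundN x c : unit_bound x c -> unit_bound (- x) c.
Proof.
case=> x2 xa; split=> [|a]; first by rewrite rnormN.
have -> : unit_lact (- x) a = - unit_lact x a.
  rewrite /unit_lact opprD -scaleNr -[- amul _ _]sub0r -(amul0l a).
  by rewrite -amulBl sub0r.
by rewrite rnormN.
Qed.

Lemma unit_boundD x y c d :
  unit_bound x c -> unit_bound y d -> unit_bound (x + y) (c + d).
Proof.
case=> x2 xa [y2 ya]; split=> [|a].
  by apply: le_trans (rnormD _ _) _; exact: lerD.
by rewrite unit_lactDl mulrDl (le_trans (rnormD _ _)) // lerD.
Qed.

Lemma unit_boundM x y c d :
  unit_bound x c -> unit_bound y d -> unit_bound (x * y) (c * d).
Proof.
move=> bx; have c0 := unit_bound_ge0 bx.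
case: bx => x2 xa [y2 ya]; split=> [|a].
  by rewrite rnormM ler_pM ?rnorm_ge0.
rewrite unit_lactM (le_trans (xa _)) // -mulrA; exact: ler_wpM2l.
Qed.

(** On scalar parts this is the inequality for real squares. On [A] it is [rnorm_sqrD] at [p = x a]
    and [q = y a]: as [x] and [y] are self-adjoint and commute, [p^* p + q^* q] is [x ^ 2 + y ^ 2]
    applied to [a], multiplied on the left by [astar a]. *)
Lemma unit_bound_sqrD x y c :
  astar x.1 = x.1 -> Num.conj x.2 = x.2 ->
  astar y.1 = y.1 -> Num.conj y.2 = y.2 -> x * y = y * x ->
  0 <= c -> unit_bound (x ^+ 2 + y ^+ 2) (c ^+ 2) -> unit_bound x c.
Proof.
move=> x1 x2 y1 y2 xy c0 [b2 ba]; split=> [|a].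
  rewrite -(@ler_pXn2r _ 2) ?nnegrE ?rnorm_ge0 //; apply: le_trans b2.
  have xr : x.2 \is Num.real by apply/CrealP.
  have yr : y.2 \is Num.real by apply/CrealP.
  rewrite -lecR rmorphXn /= -!rnormE real_normK // !expr2 /=.
  apply: (@le_trans _ _ (x.2 ^+ 2 + y.2 ^+ 2)).
    by rewrite -expr2 lerDl real_exprn_even_ge0.
  by rewrite real_ler_norm // realD ?realX.
have adj (z w : unit_alg A) : astar z.1 = z.1 -> Num.conj z.2 = z.2 ->
    amul (astar (unit_lact z a)) (unit_lact w a) =
    amul (astar a) (unit_lact (z * w) a).
  by move=> z1 z2; rewrite unit_lact_adjoint // unit_lactM.
have : rnorm (unit_lact x a) ^+ 2 <= (c * rnorm a) ^+ 2.
  apply: le_trans (@rnorm_sqrD _ _ _ (unit_lact y a) _) _.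
    by rewrite !adj // xy.
  rewrite !adj // -amulDr -unit_lactDl -!expr2.
  apply: le_trans (rnorm_amul _ _) _; rewrite rnorm_astar.
  have := ba a; have := rnorm_ge0 a; nra.
by rewrite ler_pXn2r ?nnegrE ?mulr_ge0 ?rnorm_ge0.
Qed.
End UnitAction.

(** * The commutative algebra generated by a self-adjoint element *)

Section Bicommutant.
Context {R : realType} {A : cstarAlgType R}.
Implicit Types (a b h : A).

(* Self-adjoint elements of the unitization that commute with everything that
   commutes with [h]: a commutative real algebra, closed for the norm. *)
Definition sa_bicomm h : {pred unit_alg A} := fun x =>
  `[< [/\ astar x.1 = x.1, Num.conj x.2 = x.2 &
       forall a, amul a h = amul h a -> amul x.1 a = amul a x.1] >].

Lemma sa_bicommP h (x : unit_alg A) : reflect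
  [/\ astar x.1 = x.1, Num.conj x.2 = x.2 &
      forall a, amul a h = amul h a -> amul x.1 a = amul a x.1]
  (x \in sa_bicomm h).
Proof. exact: asboolP. Qed.

Lemma unit_alg_ext (x y : unit_alg A) : x.1 = y.1 -> x.2 = y.2 -> x = y.
Proof. by case: x y => [? ?] [? ?] /= -> ->. Qed.

Lemma fst_unit_mul (x y : unit_alg A) :
  (x * y).1 = amul x.1 y.1 + x.2 *: y.1 + y.2 *: x.1.
Proof. by []. Qed.

Lemma snd_unit_mul (x y : unit_alg A) : (x * y).2 = x.2 * y.2.
Proof. by []. Qed.

(** Since [h] commutes with itself, [y.1] commutes with [h], and therefore with [x.1]. *)
Lemma sa_bicomm_comm h (x y : unit_alg A) :
  x \in sa_bicomm h -> y \in sa_bicomm h -> x * y = y * x.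
Proof.
move=> /sa_bicommP[_ _ xh] /sa_bicommP[_ _ yh].
have xy : amul x.1 y.1 = amul y.1 x.1 by apply/xh/yh.
apply: unit_alg_ext; rewrite ?fst_unit_mul ?snd_unit_mul ?xy 1?mulrC //.
by rewrite addrAC.
Qed.

Lemma sa_bicomm_subring h : subring_closed (sa_bicomm h).
Proof.
split.
- apply/sa_bicommP; split=> /= [||a _]; rewrite ?astar0 ?rmorph1 //.
  by rewrite amul0l amul0r.
- move=> x y /sa_bicommP[x1 x2 xh] /sa_bicommP[y1 y2 yh]; apply/sa_bicommP.
  split=> /= [||a ah]; first by rewrite astarB x1 y1.
    by rewrite rmorphB /= x2 y2.
  by rewrite [LHS]amulBl [RHS]amulBr xh // yh.
- move=> x y xB yB; have xy := sa_bicomm_comm xB yB.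
  move: xB yB => /sa_bicommP[x1 x2 xh] /sa_bicommP[y1 y2 yh]; apply/sa_bicommP.
  split=> /= [||a ah]; last first.
  + have xya : amul (amul x.1 y.1) a = amul a (amul x.1 y.1).
      by rewrite -amulA yh // amulA xh // amulA.
    by rewrite !amulDl !amulDr !amulZl !amulZr xya (xh a) // (yh a).
  + by rewrite rmorphM /= x2 y2.
  + have xy1 : amul x.1 y.1 = amul y.1 x.1 by apply/xh/yh.
    by rewrite !astarD !astarZ astarM x1 y1 x2 y2 xy1.
Qed.

HB.instance Definition _ h :=
  GRing.isSubringClosed.Build (unit_alg A) (sa_bicomm h) (sa_bicomm_subring h).

Record sa_algebra h := SaAlgebra {
  sa_val :> unit_alg A ;
  sa_valP : sa_val \in sa_bicomm h
}.

HB.instance Definition _ h := [isSub for @sa_val h].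
HB.instance Definition _ h := [Choice of sa_algebra h by <:].
HB.instance Definition _ h := [SubChoice_isSubNzRing of sa_algebra h by <:].

Lemma sa_algebra_mulC h : commutative (@GRing.mul (sa_algebra h)).
Proof. by move=> x y; apply/val_inj/(sa_bicomm_comm (valP x) (valP y)). Qed.

HB.instance Definition _ h :=
  GRing.PzRing_hasCommutativeMul.Build (sa_algebra h) (@sa_algebra_mulC h).

Definition sa_gauge h (x : sa_algebra h) (c : R) : Prop :=
  unit_bound (val x) c.

(** The components in [A] and in the scalars converge separately, both dominated by [t].
    Self-adjointness and commutation pass to the limit by continuity of [astar] and of the
    product. *)
Lemma sa_gauge_complete h (f : nat -> sa_algebra h) (t : nat -> R) :
  (forall k, sa_gauge (f k.+1 - f k) (t k.+1 - t k)) -> (forall k, t k <= 1) ->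
  exists x, forall e, 0 < e ->
    exists k, sa_gauge (x - f k) e /\ sa_gauge (x - f k.+1) e.
Proof.
move=> bf t_le1.
pose u k : A := (val (f k)).1; pose l k := complex.Re (val (f k)).2.
have lE k : (val (f k)).2 = (real_complex R) (l k).
  rewrite RRe_real //; apply/CrealP.
  by have /sa_bicommP[] := valP (f k).
have t_incr k : t k <= t k.+1.
  by rewrite -subr_ge0; exact: unit_bound_ge0 (bf k).
have step1 k : rnorm (u k - u k.+1) <= 2 * (t k.+1 - t k).
  by rewrite -rnormN opprB; exact: unit_bound_fst (bf k).
have step2 k : `|l k - l k.+1| <= 1 * (t k.+1 - t k).
  rewrite -rnormC rmorphB /= -!lE mul1r -rnormN opprB.
  by have [] := bf k.
have dist1 i j k : rnorm (u i - u k) <= rnorm (u i - u j) + rnorm (u j - u k).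
  by rewrite -[u i - u k](subrKA (u j)) rnormD.
have dist2 i j k : `|l i - l k| <= `|l i - l j| + `|l j - l k|.
  by rewrite -[l i - l k](subrKA (l j)) ler_normD.
have [|a ua] := @cauchy_seq_lim _ A u.
  move=> e e0.
  have e0' : 0 < complex.Re e by move: e0; rewrite ltcE /= => /andP[].
  have [||N uN] := @summable_steps_cauchy _ (fun i j => rnorm (u i - u j)) t 2
    _ dist1 _ step1 t_incr t_le1 _ e0' => //.
    by move=> k; rewrite subrr rnorm0.
  exists N => k /uN; rewrite rnormE ltcE /= => ->; rewrite andbT.
  by move: e0; rewrite ltcE /= => /andP[/eqP -> _].
have [|r lr] := @cauchy_seq_lim _ R^o l.
  move=> e e0.
  have [||N uN] := @summable_steps_cauchy _ (fun i j => `|l i - l j|) t 1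
    _ dist2 _ step2 t_incr t_le1 _ e0 => //.
    by move=> k; rewrite subrr normr0.
  by exists N.
have near_a e : 0 < e -> exists N, forall k, (N <= k)%N -> rnorm (a - u k) <= e.
  move=> e0; have [|N uN] := ua (real_complex R e); first by rewrite ltcR.
  by exists N => k /uN; rewrite rnormE lecR.
have xP : ((a, real_complex R r) : unit_alg A) \in sa_bicomm h.
  apply/sa_bicommP; split=> /=.
  - apply/eqP; rewrite -subr_eq0; apply/eqP/(@rnorm_small _ _ _ 2) => e e0.
    have [N /(_ _ (leqnn N)) aN] := near_a _ e0.
    have /sa_bicommP[uN _ _] := valP (f N).
    have -> : astar a - a = astar (a - u N) - (a - u N).
      by rewrite astarB uN opprB addrA subrK.
    apply: le_trans (rnormD _ _) _; rewrite rnormN rnorm_astar.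
    by rewrite mulr_natl mulr2n lerD.
  - exact: conj_real_complex.
  - move=> b bh; apply/eqP; rewrite -subr_eq0; apply/eqP.
    apply: (@rnorm_small _ _ _ (2 * rnorm b)) => e e0.
    have [N /(_ _ (leqnn N)) aN] := near_a _ e0.
    have /sa_bicommP[_ _ /(_ _ bh) uN] := valP (f N).
    have -> : amul a b - amul b a = amul (a - u N) b - amul b (a - u N).
      by rewrite amulBl amulBr uN opprB addrA subrK.
    apply: le_trans (rnormD _ _) _; rewrite rnormN.
    have := rnorm_amul (a - u N) b; have := rnorm_amul b (a - u N).
    have := rnorm_ge0 b; nra.
exists (SaAlgebra xP) => e e0; have e2 : 0 < e / 2 by lra.
have [N1 aN] := near_a _ e2; have [N2 lN] := lr _ e2.
pose k := maxn N1 N2.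
have close j : (k <= j)%N -> sa_gauge (SaAlgebra xP - f j) e.
  rewrite geq_max => /andP[j1 j2].
  have /unit_bound_le :
      rnorm (a - u j) + rnorm (real_complex R r - (val (f j)).2) <= e.
    rewrite lE -rmorphB /= rnormC; have := aN _ j1; have := lN _ j2; lra.
  by apply; exact: (unit_bound_rnorm (val (SaAlgebra xP - f j))).
by exists k; split; apply: close; rewrite // leqnSn.
Qed.

Lemma sa_gauge_cstar h : cstar_gauge (@sa_gauge h).
Proof.
split.
- by move=> x c d; exact: unit_bound_le.
- by move=> x c; exact: unit_bound_closed.
- move=> x; exists (rnorm (val x).1 + rnorm (val x).2).
  exact: unit_bound_rnorm.
- by move=> x /unit_bound0 x0; exact: val_inj.
- split=> [|a]; first by rewrite /= rnorm0.
  by rewrite /unit_lact /= amul0l scale0r addr0 rnorm0 mul0r.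
- split=> [|a]; first by rewrite /= rnorm1.
  by rewrite /unit_lact /= amul0l scale1r add0r mul1r.
- by move=> x c; exact: unit_boundN.
- by move=> x y c d; exact: unit_boundD.
- by move=> x y c d; exact: unit_boundM.
- move=> x y c c0; have /sa_bicommP[x1 x2 _] := valP x.
  have /sa_bicommP[y1 y2 _] := valP y.
  have xy := sa_bicomm_comm (valP x) (valP y).
  exact: unit_bound_sqrD.
- have hP : ((0, real_complex R 2^-1) : unit_alg A) \in sa_bicomm h.
    apply/sa_bicommP; split=> /=; first exact: astar0.
      exact: conj_real_complex.
    by move=> a _; rewrite amul0l amul0r.
  exists (SaAlgebra hP).
    apply: val_inj; apply: unit_alg_ext => /=; first exact: addr0.
    by rewrite -rmorphD /= -[2^-1]div1r -splitr.
  split=> [|a] /=; first by rewrite rnormC ger0_norm ?invr_ge0.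
  by rewrite /unit_lact /= amul0l add0r rnormZ rnormC ger0_norm ?invr_ge0.
- exact: sa_gauge_complete.
Qed.

End Bicommutant.

(** * Modules *)

Section RightModules.
Context {R : realType} {A : cstarAlgType R}.
Implicit Types (a b : A) (x y : unit_alg A).

Lemma ractDl (E : rightModType A) (e f : E) a :
  ract (e + f) a = ract e a + ract f a.
Proof. by have := ract_linearl 1 e f a; rewrite !scale1r. Qed.

Lemma ractDr (E : rightModType A) (e : E) a b :
  ract e (a + b) = ract e a + ract e b.
Proof. by have := ract_linearr 1 e a b; rewrite !scale1r. Qed.

Lemma ract0l (E : rightModType A) a : ract (0 : E) a = 0.
Proof. by apply: (addrI (ract 0 a)); rewrite -ractDl !addr0. Qed.

Lemma ract0r (E : rightModType A) (e : E) : ract e 0 = 0.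
Proof. by apply: (addrI (ract e 0)); rewrite -ractDr !addr0. Qed.

Lemma ractZl (E : rightModType A) l (e : E) a :
  ract (l *: e) a = l *: ract e a.
Proof. by have := ract_linearl l e 0 a; rewrite ract0l !addr0. Qed.

Lemma ractZr (E : rightModType A) l (e : E) a :
  ract e (l *: a) = l *: ract e a.
Proof. by have := ract_linearr l e a 0; rewrite ract0r !addr0. Qed.

(** With this extension 1 acts as the identity even if the action of [A] is degenerate. *)
Definition unit_ract (E : rightModType A) (e : E) x : E :=
  ract e x.1 + x.2 *: e.

Lemma unit_ractDl (E : rightModType A) (e f : E) x :
  unit_ract (e + f) x = unit_ract e x + unit_ract f x.
Proof. by rewrite /unit_ract ractDl scalerDr addrACA. Qed.

Lemma unit_ractDr (E : rightModType A) (e : E) x y :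
  unit_ract e (x + y) = unit_ract e x + unit_ract e y.
Proof. by rewrite /unit_ract ractDr scalerDl addrACA. Qed.

Lemma unit_ractM (E : rightModType A) (e : E) x y :
  unit_ract e (x * y) = unit_ract (unit_ract e x) y.
Proof.
rewrite /unit_ract fst_unit_mul snd_unit_mul !ractDr !ractDl !ractZr !ractZl.
rewrite ractM scalerDr scalerA (mulrC y.2).
by rewrite !addrA.
Qed.

Lemma unit_ract0 (E : rightModType A) (e : E) : unit_ract e 0 = 0.
Proof. by rewrite /unit_ract ract0r scale0r addr0. Qed.

Lemma unit_ract1 (E : rightModType A) (e : E) : unit_ract e 1 = e.
Proof. by rewrite /unit_ract /= ract0r scale1r add0r. Qed.

Lemma unit_ract_emb (E : rightModType A) (e : E) a :
  unit_ract e ((a, 0) : unit_alg A) = ract e a.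
Proof. by rewrite /unit_ract /= scale0r addr0. Qed.

(** The part in [A], of norm at most [2 * c], gives [2 * K]; the scalar part gives 1. *)
Lemma rnorm_unit_ract (E : rightModType A) (K : R) (e : E) x c :
  0 <= K -> (forall a, rnorm (ract e a) <= K * rnorm e * rnorm a) ->
  unit_bound x c -> rnorm (unit_ract e x) <= (2 * K + 1) * c * rnorm e.
Proof.
move=> K0 bE bx; have x1 := unit_bound_fst bx; have [x2 _] := bx.
apply: le_trans (rnormD _ _) _; rewrite rnormZ.
have := bE x.1; have e0 := rnorm_ge0 e.
have : K * rnorm e * rnorm x.1 <= K * rnorm e * (2 * c).
  by rewrite ler_wpM2l // mulr_ge0.
have : rnorm x.2 * rnorm e <= c * rnorm e by rewrite ler_wpM2r.
lra.
Qed.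

Lemma banach_ract_bound (E : banachRightModType A) :
  exists2 K : R, 0 <= K &
    forall (e : E) a, rnorm (ract e a) <= K * rnorm e * rnorm a.
Proof.
have [K bK] := @ract_bounded _ _ E; exists (rnorm K); first exact: rnorm_ge0.
move=> e a; rewrite -mulrA; apply: le_normM.
  by rewrite mulr_ge0 ?rnorm_ge0.
by rewrite rmorphM /= -!rnormE mulrA.
Qed.

Section HilbertModule.
Context (F : hilbertModType A).
Implicit Types (f g : F).

Lemma rnorm_inner f : rnorm (inner f f) = rnorm f ^+ 2.
Proof. by apply: complexI; rewrite rmorphXn /= -!rnormE normr_inner. Qed.

Lemma inner0r f : inner f 0 = 0.
Proof.
have := inner_linearr 1 f 0 0; rewrite !scale1r addr0 => h.
by apply: (addrI (inner f 0)); rewrite addr0 -h.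
Qed.

(** The inner product of [f a] with itself is [a^* <f, f> a]. *)
Lemma hilbert_ract_bound f a : rnorm (ract f a) <= rnorm f * rnorm a.
Proof.
rewrite -(@ler_pXn2r _ 2) ?nnegrE ?mulr_ge0 ?rnorm_ge0 // -rnorm_inner.
rewrite inner_ract -inner_star inner_ract.
apply: le_trans (rnorm_amul _ _) _; rewrite rnorm_astar.
have := rnorm_amul (inner f f) a; rewrite rnorm_inner.
have := rnorm_ge0 a; nra.
Qed.

(** Each [<f, f> a = <f, f a>] vanishes, and [A] acts faithfully on itself. *)
Lemma hilbert_ract_faithful f : (forall a, ract f a = 0) -> f = 0.
Proof.
move=> f0; apply/inner_eq0/amul_faithful => a.
by rewrite -inner_ract f0 inner0r.
Qed.

End HilbertModule.

(** [A] is an ideal of its unitization: if [x] kills [e], so does each [x a], which lies in [A]. By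
    locality every [a] then kills [unit_ract (theta e) x], and the action on [F] is faithful. *)
Lemma local_map_unit (E : rightModType A) (F : hilbertModType A)
    (theta : E -> F) (e : E) x :
  local_map theta -> unit_ract e x = 0 -> unit_ract (theta e) x = 0.
Proof.
move=> loc ex; apply: hilbert_ract_faithful => a.
have E0 (G : rightModType A) (g : G) :
    ract (unit_ract g x) a = ract g (unit_lact x a).
  by rewrite /unit_ract /unit_lact ractDl ractDr ractZl ractZr ractM.
by rewrite E0; apply: loc; rewrite -E0 ex ract0l.
Qed.

End RightModules.

(** * Bounded local maps are module maps *)

Section LocalMaps.
Context {R : realType} {A : cstarAlgType R}.
Context (E : banachRightModType A) (F : hilbertModType A).
Context (theta : {linear E -> F}).
Hypothesis theta_bounded : bounded_operator theta.
Hypothesis theta_local : local_map theta.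

Let theta_bound :
  exists2 M : R, 0 <= M & forall e, rnorm (theta e) <= M * rnorm e.
Proof.
have [M bM] := theta_bounded; exists (rnorm M); first exact: rnorm_ge0.
by move=> e; apply: le_normM (rnorm_ge0 _) _; rewrite -rnormE.
Qed.

Let local_ract_contraction (h : A) (e : E) :
  astar h = h -> rnorm h <= 1 -> theta (ract e h) = ract (theta e) h.
Proof.
move=> hs h1.
have vP : ((h, 0) : unit_alg A) \in sa_bicomm h.
  by apply/sa_bicommP; split=> //=; rewrite rmorph0.
pose v := SaAlgebra vP.
have bv : sa_gauge v 1.
  split=> [|a]; first by rewrite /= rnorm0.
  rewrite /unit_lact /= scale0r addr0; apply: le_trans (rnorm_amul _ _) _.
  by rewrite ler_wpM2r ?rnorm_ge0.
pose V (x y : sa_algebra h) := unit_ract (theta (unit_ract e (val x))) (val y).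
have [K K0 bK] := banach_ract_bound E; have [M M0 bM] := theta_bound.
(* Both arguments of [V] have gauge at most 2: the inner action costs [(2 * K + 1) * 2], [theta]
   costs [M], and the action on [F], where [K] is 1, costs [(2 * 1 + 1) * 2]. *)
pose C := (2 * 1 + 1) * 2 * (M * ((2 * K + 1) * 2 * rnorm e)).
have VDl x y z : V (x + y) z = V x z + V y z.
  by rewrite /V unit_ractDr linearD unit_ractDl.
have VDr x y z : V x (y + z) = V x y + V x z by rewrite /V unit_ractDr.
have V0 x y : x * y = 0 -> V x y = 0.
  move=> xy; apply: local_map_unit => //; rewrite -unit_ractM.
  by rewrite -[_ * _]/(val (x * y)) xy unit_ract0.
have bV x y : sa_gauge x 2 -> sa_gauge y 2 -> `|V x y| <= (real_complex R) C.
  move=> bx by_; rewrite rnormE lecR.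
  apply: le_trans (rnorm_unit_ract ler01 _ by_) _.
    by move=> a; rewrite mul1r hilbert_ract_bound.
  apply: ler_wpM2l; first lra.
  apply: le_trans (bM _) _; apply: ler_wpM2l => //.
  exact: (rnorm_unit_ract K0 (bK e)).
have small m : rnorm (V v 1 - V 1 v) *+ 2 ^ m <= C *+ 6.
  have := zero_product_bound (sa_gauge_cstar h) VDl VDr V0 bV m bv.
  by rewrite rnormE -!rmorphMn lecR.
have -> : theta (ract e h) = V v 1.
  by rewrite /V /= unit_ract_emb unit_ract1.
have -> : ract (theta e) h = V 1 v.
  by rewrite /V /= unit_ract_emb unit_ract1.
(* Archimedean argument: a positive norm, multiplied by [2 ^ m], would exceed [6 C] for large
   [m]. *)
apply/eqP; rewrite -subr_eq0; apply/eqP/rnorm_eq0; rewrite leNgt; apply/negP.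
set X := rnorm _ in small *; move=> X0.
have := unstable.ltr_bound (C *+ 6 / X); set m := Num.bound _ => Cm.
have := small m; rewrite leNgt => /negP; apply; rewrite -[X *+ _]mulr_natl.
move: Cm; rewrite ltr_pdivrMr // => /lt_le_trans; apply.
by rewrite ler_pM2r // ler_nat ltnW // ltn_expl.
Qed.

Lemma local_map_ract (e : E) (a : A) : theta (ract e a) = ract (theta e) a.
Proof.
have sa h : astar h = h -> theta (ract e h) = ract (theta e) h.
  (* The added 1 keeps [r] invertible when [h] is 0. *)
  move=> hs; pose r := rnorm h + 1.
  have r0 : 0 < r by rewrite ltr_wpDl ?rnorm_ge0.
  have rN : (real_complex R) r != 0.
    by rewrite -(rmorph0 (real_complex R)) (inj_eq (@complexI R)) gt_eqF.
  have -> : h = (real_complex R) r *: ((real_complex R r)^-1 *: h).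
    by rewrite scalerA divff // scale1r.
  rewrite !ractZr linearZ /= -[ract e h]scale1r; congr (_ *: _).
  rewrite scale1r -!ractZr; apply: local_ract_contraction.
    by rewrite astarZ hs -fmorphV conj_real_complex.
  rewrite rnormZ -fmorphV rnormC gtr0_norm ?invr_gt0 //.
  by rewrite ler_pdivrMl // mulr1 lerDl.
have [i i2 ci] : exists2 i : R[i], i * i = -1 & Num.conj i = - i.
  by exists 'i; rewrite ?conjCi // -expr2 sqrCi.
have saC p q : astar p = p -> astar q = q ->
    theta (ract e (2^-1 *: (p + i *: q))) =
    ract (theta e) (2^-1 *: (p + i *: q)).
  move=> ps qs; rewrite !ractZr !ractDr !ractZr linearZ linearD linearZ /=.
  by rewrite !sa.
(* The decomposition into self-adjoint real and imaginary parts, with the factor one half pulled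
   out. *)
have -> : a = 2^-1 *: ((a + astar a) + i *: ((- i) *: (a - astar a))).
  rewrite scalerA mulrN i2 opprK scale1r addrACA subrr addr0.
  by rewrite -mulr2n -[a *+ 2]scaler_nat scalerA mulVf ?pnatr_eq0 // scale1r.
apply: saC; first by rewrite astarD astarK addrC.
by rewrite astarZ rmorphN /= ci opprK astarB astarK scaleNr -scalerN opprB.
Qed.

End LocalMaps.

Theorem propositionA1 (R : realType) (A : cstarAlgType R)
    (E : banachRightModType A) (F : hilbertModType A)
    (theta : {linear E -> F}) (theta_bounded : bounded_operator theta) :
  right_module_map theta <-> local_map theta.
Proof.
split=> [mod e a ea0|loc e a]; first by rewrite -mod ea0 linear0.
exact: local_map_ract.
Qed.
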